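(* For every dimension $n\ge 3$ there exists a global, non-classical viscosity solution of $$\Big(\prod_{i=1}^n u_{ii}\Big)^{1/n}=1,\qquad u \text{ coordinate-convex}.$$ That is, there exists a continuous coordinate-convex function $u:\mathbb{R}^n\to\mathbb{R}$ that is a viscosity solution of this equation on all of $\mathbb{R}^n$ and that is not of class $C^2$ on $\mathbb{R}^n$.
   Context: Subscripts denote partial derivatives: $u_{ii}=\partial_i^2u$. A continuous function on $\mathbb{R}^n$ is called coordinate-convex if it is convex when restricted to lines parallel to the coordinate axes. A continuous coordinate-convex function $u$ is a viscosity solution of $(\prod_{i=1}^n u_{ii})^{1/n}=1$ in an open set $\Omega$ if for every $x_0\in\Omega$ and every $C^2$ function $\psi$ defined near $x_0$ with $\psi(x_0)=u(x_0)$: (i) if $\psi\ge u$ near $x_0$, then $\psi_{ii}(x_0)\ge0$ for all $i$ and $\prod_{i=1}^n\psi_{ii}(x_0)\ge 1$; (ii) if $\psi\le u$ near $x_0$ and $\psi_{ii}(x_0)\ge0$ for all $i$, then $\prod_{i=1}^n\psi_{ii}(x_0)\le1$. *)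

(* Defs.v *)
From HB Require Import structures.
From mathcomp Require Import all_boot all_order all_algebra.
From mathcomp Require Import all_classical all_reals all_analysis.

Set Implicit Arguments.
Unset Strict Implicit.
Unset Printing Implicit Defensive.

Import Order.TTheory GRing.Theory Num.Theory.
Import numFieldNormedType.Exports.

Local Open Scope classical_set_scope.
Local Open Scope ring_scope.

Definition partial (R : realType) (n : nat) (i : 'I_n) (f : 'rV[R]_n -> R) :
  'rV[R]_n -> R := 'D_(delta_mx 0 i) (f : 'rV[R]_n -> R^o).

(* The class C^k on an open set U. Since f is a total function, continuity and
   differentiability are meant at each point of U in the ambient topology of
   R^n; only the values of f on U matter when U is open. *)
Fixpoint Ck_on (R : realType) (n : nat) (k : nat) (U : set 'rV[R]_n)
    (f : 'rV[R]_n -> R) : Prop :=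
  (forall x, U x -> {for x, continuous f}) /\
  (if k is k'.+1 then
     forall i : 'I_n,
       (forall x, U x -> derivable (f : 'rV[R]_n -> R^o) x (delta_mx 0 i)) /\
       Ck_on k' U (partial i f)
   else True).

Definition Ck_near (R : realType) (n : nat) (k : nat) (x0 : 'rV[R]_n)
    (f : 'rV[R]_n -> R) : Prop :=
  exists U : set 'rV[R]_n, open_nbhs x0 U /\ Ck_on k U f.

Definition coordinate_convex (R : realType) (n : nat) (u : 'rV[R]_n -> R) :
  Prop :=
  forall (x : 'rV[R]_n) (i : 'I_n),
    convex_function [set: R^o] (fun t : R^o => u (x + t *: delta_mx 0 i)).

(* Viscosity solutions of (prod_i u_ii)^(1/n) = 1 in the open set Omega, for u
   continuous and coordinate-convex. A test function defined near x0 is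
   represented by a total function, constrained only near x0. *)
Definition viscosity_subsolution (R : realType) (n : nat)
    (Omega : set 'rV[R]_n) (u : 'rV[R]_n -> R) : Prop :=
  forall (x0 : 'rV[R]_n) (psi : 'rV[R]_n -> R),
    Omega x0 -> Ck_near 2 x0 psi -> psi x0 = u x0 ->
    (\forall x \near x0, u x <= psi x) ->
    (forall i : 'I_n, 0 <= partial i (partial i psi) x0) /\
    1 <= \prod_(i < n) partial i (partial i psi) x0.

Definition viscosity_supersolution (R : realType) (n : nat)
    (Omega : set 'rV[R]_n) (u : 'rV[R]_n -> R) : Prop :=
  forall (x0 : 'rV[R]_n) (psi : 'rV[R]_n -> R),
    Omega x0 -> Ck_near 2 x0 psi -> psi x0 = u x0 ->
    (\forall x \near x0, psi x <= u x) ->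
    (forall i : 'I_n, 0 <= partial i (partial i psi) x0) ->
    \prod_(i < n) partial i (partial i psi) x0 <= 1.

Definition viscosity_solution (R : realType) (n : nat)
    (Omega : set 'rV[R]_n) (u : 'rV[R]_n -> R) : Prop :=
  viscosity_subsolution Omega u /\ viscosity_supersolution Omega u.

(* Main.v *)
Require Import Defs.
From HB Require Import structures.
From mathcomp Require Import all_boot all_order all_algebra.
From mathcomp Require Import all_classical all_reals all_analysis.
From mathcomp Require Import ring lra.
Import Order.TTheory GRing.Theory Num.Theory.
Import numFieldNormedType.Exports.
Local Open Scope classical_set_scope.
Local Open Scope ring_scope.

(** The solution is explicit.  With [s = x_1 + x_2] and [z = x_3], put
      [u = |s| z^2 / 2 + (4/3) |s|^(3/2) + (x_4^2 + ... + x_n^2) / 2].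
    Where [s <> 0] its pure second derivatives are
      [u_11 = u_22 = |s|^(-1/2)], [u_33 = |s|], [u_ii = 1] for [i > 3],
    whose product is [1].  All the singularities lie on the hyperplane [s = 0],
    which is transversal to the first two axes and contains the others.  There
    - no [C^2] function touches [u] from above, because along the first axis
      [u] grows at least like [(4/3) |t|^(3/2)]
      ([sing_sol_no_C2_above]); so the subsolution test is vacuous, and [u]
      itself is not [C^2];
    - a [C^2] function touching from below has nonpositive third pure second
      derivative, because [u] is constant along the third axis; so if its pure
      second derivatives are nonnegative then their product is zero.

    Pure second derivatives are handled through symmetric second difference
    quotients in one variable.  For a [C^2] function they converge to the pure
    second derivative ([second_quotient_line]), and when one function touches
    another their limits are ordered ([second_quotient_le]).  On every
    coordinate line [u] has the shape [profile], whose difference quotients are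
    computed algebraically ([second_quotient_profile]). *)

(** * Symmetric second difference quotients *)

(** The symmetric second difference quotient of [f] at [0] with step [t]. *)
Definition second_quotient {R : realType} (f : R -> R) (t : R) : R :=
  (f t + f (- t) - 2 * f 0) / t ^+ 2.

(** Differentiability of [df] at the single point [0] suffices: the quotient
    equals the mean of two difference quotients of [df] at an intermediate
    point [c] and at [- c]. *)
Lemma second_quotient_cvg {R : realType} (f df : R -> R) (l : R) :
  (\forall t \near (0 : R), is_derive (t : R) (1 : R) f (df t)) ->
  is_derive (0 : R) (1 : R) df l ->
  second_quotient f t @[t --> 0^'] --> l.
Proof.
move=> f_df df_l.
have dfl : h^-1 *: (df (h *: 1 + 0) - df 0) @[h --> 0^'] --> l.
  by have [? <-] := df_l.
apply/cvgrPdist_lt => e e0.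
have [d1 /= d1_gt0 d1P] := f_df.
have /cvgrPdist_lt /(_ e e0) := dfl.
rewrite near_withinE => -[d2 /= d2_gt0 d2P].
pose d := Num.min d1 d2.
have d_gt0 : 0 < d by rewrite lt_min d1_gt0.
have slope h : `|h| < d -> h != 0 -> `|l - (df h - df 0) / h| < e.
  rewrite lt_min => /andP[_ hd] h0.
  have := d2P h _ h0; rewrite /= add0r normrN => /(_ hd).
  by rewrite addr0 /GRing.scale /= mulr1 mulrC.
have main t : 0 < t < d -> `|l - second_quotient f t| < e.
  move=> /andP[t0 td].
  pose k := second_quotient f t.
  have kE : k * t ^+ 2 = f t + f (- t) - 2 * f 0.
    by rewrite /k /second_quotient divfK// expf_neq0// gt_eqF.
  have derf h : `|h| < d -> is_derive (h : R) (1 : R) f (df h).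
    by rewrite lt_min => /andP[hd _]; apply: d1P; rewrite /= add0r normrN.
  (* F t = F 0 by the choice of k, so the derivative of F vanishes inside *)
  pose F h := f h + f (- h) - k * h ^+ 2.
  have derF h : `|h| < d ->
      is_derive (h : R) (1 : R) F (df h - df (- h) - k * (2 * h)).
    move=> hd; have ? := derf h hd.
    have ? : is_derive (- h) (1 : R) f (df (- h)) by apply: derf; rewrite normrN.
    have -> : df h - df (- h) - k * (2 * h) = df h + df (- h) * -1 - k *: (h *+ 2).
      rewrite /GRing.scale /=; ring.
    have fN : is_derive h (1 : R) (fun x => f (- x)) (df (- h) * -1).
      exact: (is_derive1_comp (g := -%R)).
    have sq : is_derive h (1 : R) (fun x : R => x ^+ 2) (h *+ 2).
      by apply: is_derive_eq; rewrite /GRing.scale /= mulr1.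
    have := is_deriveB (is_deriveD (derf h hd) fN) (is_deriveZ k sq).
    exact.
  have [c] : exists2 c, c \in `]0, t[%R &
      F t - F 0 = (df c - df (- c) - k * (2 * c)) * (t - 0).
    apply: MVT => //.
      move=> x; rewrite in_itv /= => /andP[x0 xt]; apply: derF.
      by rewrite gtr0_norm// (lt_trans xt).
    apply: derivable_within_continuous => x; rewrite in_itv /= => /andP[x0 xt].
    have := derF x; rewrite ger0_norm// => /(_ (le_lt_trans xt td)) [].
    done.
  rewrite in_itv /= => /andP[c0 ct].
  rewrite /F oppr0 kE expr0n /= mulr0 !subr0.
  have -> : f t + f (- t) - (f t + f (- t) - 2 * f 0) - (f 0 + f 0) = 0 by ring.
  move/esym/eqP; rewrite addr0 mulf_eq0 (gt_eqF t0) orbF => /eqP dfc.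
  have cd : `|c| < d by rewrite gtr0_norm// (lt_trans ct).
  have c_neq0 : c != 0 by rewrite gt_eqF.
  have s1 := slope c cd c_neq0.
  have : `|l - (df (- c) - df 0) / - c| < e.
    by apply: slope; rewrite ?normrN// oppr_eq0.
  rewrite -/k.
  have -> : l - k = 2^-1 * (l - (df c - df 0) / c) +
                    2^-1 * (l - (df (- c) - df 0) / - c).
    have -> : k = (df c - df (- c)) / (2 * c).
      have c2_neq0 : 2 * c != 0 by rewrite mulf_neq0.
      apply: (mulIf c2_neq0); rewrite divfK//.
      by apply/eqP; rewrite eq_sym -subr_eq0 dfc.
    by field.
  move=> s2; apply: le_lt_trans (ler_normD _ _) _.
  rewrite !normrM ger0_norm ?invr_ge0//; lra.
rewrite near_withinE; exists d => //= t; rewrite /= add0r normrN => td t0.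
have [tpos|tneg] := ltP 0 t.
  by apply: main; rewrite tpos -[t]gtr0_norm.
have -> : second_quotient f t = second_quotient f (- t).
  by rewrite /second_quotient opprK sqrrN [f (- t) + _]addrC.
by apply: main; rewrite oppr_gt0 lt_neqAle t0 tneg -ler0_norm.
Qed.

(** If [g] touches [f] from above at [0], their second derivatives in the
    sense of difference quotients are ordered. *)
Lemma second_quotient_le {R : realType} (f g : R -> R) (a b : R) :
  f 0 = g 0 -> (\forall t \near (0 : R), f t <= g t) ->
  second_quotient f t @[t --> 0^'] --> a ->
  second_quotient g t @[t --> 0^'] --> b -> a <= b.
Proof.
move=> fg0 [d /= d0 fg] fa gb; apply: ler_cvg_to fa gb _.
rewrite near_withinE; exists d => //= t; rewrite /= add0r normrN => td t0.
rewrite /second_quotient fg0 ler_pM2r ?invr_gt0 ?exprn_even_gt0//= lerB//.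
by rewrite lerD// fg//= add0r ?opprK// normrN.
Qed.

Lemma line_cvg {R : realType} {n : nat} (x e : 'rV[R]_n) :
  x + t *: e @[t --> (0 : R)] --> x.
Proof.
have : x + t *: e @[t --> (0 : R)] --> x + 0 *: e.
  by apply: cvgD; [exact: cvg_cst|exact: scalel_continuous].
by rewrite scale0r addr0.
Qed.

(** Difference quotients of a [C^2] function along a coordinate line. *)
Lemma second_quotient_line {R : realType} {n : nat} (psi : 'rV[R]_n -> R)
    (x : 'rV[R]_n) (i : 'I_n) : Ck_near 2 x psi ->
  second_quotient (fun t => psi (x + t *: delta_mx 0 i)) t @[t --> 0^'] -->
  partial i (partial i psi) x.
Proof.
move=> [U [[openU Ux] [_ /(_ i)[dpsi [_ /(_ i)[ddpsi _]]]]]].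
set e : 'rV[R]_n := delta_mx 0 i.
have line (f : 'rV[R]_n -> R) t : derivable (f : _ -> R^o) (x + t *: e) e ->
    is_derive (t : R) (1 : R) (fun s => f (x + s *: e)) (partial i f (x + t *: e)).
  (* the difference quotient along the line is the directional one *)
  have E : (fun h : R => h^-1 *: (f (x + (h *: 1 + t) *: e) - f (x + t *: e)))
     = (fun h => h^-1 *: ((f \o shift (x + t *: e)) (h *: e) - f (x + t *: e))).
    apply/funext => h /=; congr (_ *: (f _ - _)).
    by rewrite scalerDl addrCA; congr (_ *: _ + _); exact: mulr1.
  move=> df; split.
    by rewrite /derivable /= E.
  by rewrite /derive /partial /derive /= E.
apply: (second_quotient_cvg _ (fun t => partial i psi (x + t *: e))).
  have := line_cvg x e.
  move=> /(_ U (open_nbhs_nbhs (conj openU Ux))) U0.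
  apply: (@filterS _ (nbhs (0 : R)) _ _ _ _ U0) => t Ut.
  exact/line/dpsi.
have := line (partial i psi) 0; rewrite scale0r addr0; apply; exact: ddpsi.
Qed.

(** * The function [|r|^(3/2)] *)

(** [|r|^(3/2)], encoded as the cube of the square root, so that identities
    about it become polynomial identities in [sqrt |r|]. *)
Definition pow32 {R : realType} (r : R) : R := Num.sqrt `|r| ^+ 3.

Lemma pow32N {R : realType} (r : R) : pow32 (- r) = pow32 r.
Proof. by rewrite /pow32 normrN. Qed.

Lemma pow32_continuous {R : realType} : continuous (@pow32 R).
Proof.
move=> x; have cn : {for x, continuous (Num.norm : R -> R)}.
  exact: norm_continuous.
have sq := continuous_comp cn (@sqrt_continuous R _).
exact: continuous_comp sq (@exprn_continuous R 3 _).
Qed.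

(** The second derivative of [|.|^(3/2)] at [s <> 0] is [(3/4) |s|^(-1/2)]. *)
Lemma second_quotient_pow32 {R : realType} (s : R) : s != 0 ->
  second_quotient (fun t => pow32 (s + t)) t @[t --> 0^'] -->
  3 / 4 / Num.sqrt `|s|.
Proof.
wlog s_gt0 : s / 0 < s.
  move=> H s0; have [/H|sle0] := ltP 0 s; first exact.
  have sN0 : 0 < - s by rewrite oppr_gt0 lt_neqAle s0.
  have := H (- s) sN0; rewrite oppr_eq0 => /(_ s0); rewrite normrN.
  apply: cvg_trans; apply: near_eq_cvg; near=> t.
  rewrite /second_quotient -[pow32 (s + t)]pow32N -[pow32 (s - t)]pow32N.
  rewrite -[pow32 (s + 0)]pow32N !opprD opprK oppr0; congr (_ / _ ); ring.
move=> _; set r := Num.sqrt `|s|.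
have r0 : 0 < r by rewrite sqrtr_gt0 normr_gt0 gt_eqF.
have rr : r ^+ 2 = s by rewrite sqr_sqrtr// gtr0_norm.
(* with x = sqrt (s + t) and y = sqrt (s - t) the quotient is G x + G y, the
   first-order terms cancelling *)
pose G (x : R) := (x + r / 2) / (x + r) ^+ 2.
have GE : 3 / 4 / r = G r + G r by rewrite /G; field; rewrite !gt_eqF ?addr_gt0.
have cG h : (h @ (0:R) --> (0:R)) -> G (Num.sqrt (s + h t)) @[t --> (0 : R)] --> G r.
  move=> h0; have sh : Num.sqrt (s + h t) @[t --> (0 : R)] --> r.
    rewrite /r gtr0_norm//.
    apply: continuous_cvg; first exact: sqrt_continuous.
    by rewrite -[X in _ --> X]addr0; apply: cvgD; [exact: cvg_cst|].
  have num : Num.sqrt (s + h t) + r / 2 @[t --> (0 : R)] --> r + r / 2.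
    by apply: cvgD sh _; exact: cvg_cst.
  have den : Num.sqrt (s + h t) + r @[t --> (0 : R)] --> r + r.
    by apply: cvgD sh _; exact: cvg_cst.
  apply: (cvgM num); apply: cvgV; first by rewrite expf_neq0// gt_eqF// addr_gt0.
  exact: (cvg_comp _ _ den (@exprn_continuous R 2 _)).
have : G (Num.sqrt (s + t)) + G (Num.sqrt (s - t)) @[t --> (0 : R)] --> G r + G r.
  apply: cvgD; apply: cG; first exact: cvg_id.
  by rewrite -[X in _ --> X]oppr0; apply: cvgN; exact: cvg_id.
rewrite -GE => /(cvg_trans (cvg_app _ (@nbhs_dnbhs R 0))).
apply: cvg_trans; apply: near_eq_cvg.
rewrite near_withinE; exists s => //= t; rewrite /= add0r normrN => ts t0.
have /andP[t1 t2] : - s < t < s by rewrite -ltr_norml.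
rewrite /second_quotient /pow32 addr0 ![`|s + _|]gtr0_norm; [|lra|lra].
rewrite -/r.
set x := Num.sqrt (s + t); set y := Num.sqrt (s - t).
have x0 : 0 <= x by exact: sqrtr_ge0.
have y0 : 0 <= y by exact: sqrtr_ge0.
have xx : x ^+ 2 = s + t by rewrite sqr_sqrtr//; lra.
have yy : y ^+ 2 = s - t by rewrite sqr_sqrtr//; lra.
have key z : 0 <= z -> (z ^+ 2 - r ^+ 2) ^+ 2 = t ^+ 2 ->
    G z = (z ^+ 3 - r ^+ 3 - 3 / 2 * r * (z ^+ 2 - r ^+ 2)) / t ^+ 2.
  move=> z0 zt; have zr : z + r != 0 by rewrite gt_eqF// ltr_wpDl.
  have t2_neq0 : t ^+ 2 != 0 by rewrite expf_neq0.
  apply: (mulIf t2_neq0); rewrite divfK// -zt /G; field.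
  done.
rewrite !key//; [|rewrite yy rr; ring|rewrite xx rr; ring].
rewrite yy xx rr; field. done.
Unshelve. all: by end_near.
Qed.

(** The tangent-line inequality; after the substitution of square roots its
    defect is [(p - r)^2 (p + r / 2)]. *)
Lemma pow32_tangent {R : realType} (a b : R) :
  pow32 b + 3 / 2 * Num.sqrt `|b| * (`|a| - `|b|) <= pow32 a.
Proof.
rewrite /pow32.
set p := Num.sqrt `|a|; set r := Num.sqrt `|b|.
have -> : `|a| = p ^+ 2 by rewrite sqr_sqrtr.
have -> : `|b| = r ^+ 2 by rewrite sqr_sqrtr.
have p0 : 0 <= p by exact: sqrtr_ge0.
have r0 : 0 <= r by exact: sqrtr_ge0.
rewrite -subr_ge0.
have -> : p ^+ 3 - (r ^+ 3 + 3 / 2 * r * (p ^+ 2 - r ^+ 2)) =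
    (p - r) ^+ 2 * (p + r / 2) by field.
by rewrite mulr_ge0 ?sqr_ge0// addr_ge0// divr_ge0.
Qed.

Lemma pow32_convex {R : realType} (w a b : R) : 0 <= w <= 1 ->
  pow32 (w * a + (1 - w) * b) <= w * pow32 a + (1 - w) * pow32 b.
Proof.
move=> /andP[w0 w1]; set c := w * a + (1 - w) * b.
have w1' : 0 <= 1 - w by rewrite subr_ge0.
have ha := ler_wpM2l w0 (pow32_tangent a c).
have hb := ler_wpM2l w1' (pow32_tangent b c).
have : `|c| <= w * `|a| + (1 - w) * `|b|.
  apply: le_trans (ler_normD _ _) _.
  by rewrite !normrM (ger0_norm w0) (ger0_norm w1').
have r0 : 0 <= 3 / 2 * Num.sqrt `|c| by rewrite mulr_ge0 ?sqrtr_ge0// divr_ge0.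
move=> /(ler_wpM2l r0).
move: ha hb; set k := 3 / 2 * Num.sqrt `|c|.
lra.
Qed.

(** * Profiles on coordinate lines *)

(** The shape of the solution on coordinate lines; [s] and [e] are the base
    points of the singular and of the quadratic part. *)
Definition profile {R : realType} (A B K s e C t : R) : R :=
  A * `|s + t| + B * pow32 (s + t) + K * (e + t) ^+ 2 + C.

Lemma profile_convex {R : realType} (A B K s e C w a b : R) :
  0 <= A -> 0 <= B -> 0 <= K -> 0 <= w <= 1 ->
  profile A B K s e C (w * a + (1 - w) * b) <=
  w * profile A B K s e C a + (1 - w) * profile A B K s e C b.
Proof.
move=> A0 B0 K0 w01; have /andP[w0 w1] := w01; rewrite /profile.
have w1' : 0 <= 1 - w by rewrite subr_ge0.
have E c : c + (w * a + (1 - w) * b) = w * (c + a) + (1 - w) * (c + b) by ring.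
rewrite !E.
have hA : `|w * (s + a) + (1 - w) * (s + b)| <= w * `|s + a| + (1 - w) * `|s + b|.
  apply: le_trans (ler_normD _ _) _.
  by rewrite !normrM (ger0_norm w0) (ger0_norm w1').
have hB := pow32_convex w (s + a) (s + b) w01.
have hK : (w * (e + a) + (1 - w) * (e + b)) ^+ 2 <=
          w * (e + a) ^+ 2 + (1 - w) * (e + b) ^+ 2.
  rewrite -subr_ge0.
  have -> : w * (e + a) ^+ 2 + (1 - w) * (e + b) ^+ 2 -
      (w * (e + a) + (1 - w) * (e + b)) ^+ 2 = w * (1 - w) * (a - b) ^+ 2 by ring.
  by apply: mulr_ge0; [exact: mulr_ge0|exact: sqr_ge0].
have := ler_wpM2l A0 hA; have := ler_wpM2l B0 hB; have := ler_wpM2l K0 hK.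
lra.
Qed.

Lemma second_quotient_profile {R : realType} (A B K s e C : R) : s != 0 ->
  second_quotient (profile A B K s e C) t @[t --> 0^'] -->
  B * (3 / 4 / Num.sqrt `|s|) + 2 * K.
Proof.
move=> s0.
have : B * second_quotient (fun t => pow32 (s + t)) t + 2 * K @[t --> 0^'] -->
    B * (3 / 4 / Num.sqrt `|s|) + 2 * K.
  apply: cvgD; last exact: cvg_cst.
  by apply: cvgMl_tmp; exact: second_quotient_pow32.
apply: cvg_trans; apply: near_eq_cvg; rewrite near_withinE.
exists `|s| => /=; first by rewrite normr_gt0.
move=> t; rewrite /= add0r normrN => ts t0.
(* the absolute value is affine between s - t and s + t *)
have abs : `|s + t| + `|s - t| = 2 * `|s|.
  have [sp|sn] := ltP 0 s.
    move: ts; rewrite (gtr0_norm sp) ltr_norml => /andP[t1 t2].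
    by rewrite !gtr0_norm; lra.
  have {}sn : s < 0 by rewrite lt_neqAle s0.
  move: ts; rewrite (ltr0_norm sn) ltr_norml => /andP[t1 t2].
  by rewrite !ltr0_norm; lra.
rewrite /second_quotient /profile !addr0.
have -> : `|s - t| = 2 * `|s| - `|s + t| by rewrite -abs; ring.
by field.
Qed.

(** At a singular point ([s = 0]) the term [(4/3) |t|^(3/2)] forces the second
    difference quotients of any majorant that agrees at [0] to grow at least
    like [|t|^(-1/2)], so they have no limit. *)
Lemma profile_kink_not_below {R : realType} (A K e C l : R) (g : R -> R) :
  0 <= A -> 0 <= K -> profile A (4 / 3) K 0 e C 0 = g 0 ->
  (\forall t \near (0 : R), profile A (4 / 3) K 0 e C t <= g t) ->
  ~ (second_quotient g t @[t --> 0^'] --> l).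
Proof.
move=> A0 K0 fg0 [d /= d0 fg] gl.
have sq0 : Num.sqrt `|t| @[t --> (0 : R)^'] --> (0 : R).
  apply: (cvg_trans (cvg_app _ (@nbhs_dnbhs R 0))).
  have cn : {for 0, continuous (Num.norm : R -> R)} by exact: norm_continuous.
  have sqrt_norm0 : Num.sqrt `|0 : R| = 0 by rewrite normr0 sqrtr0.
  rewrite -[X in _ --> X]sqrt_norm0.
  exact: continuous_comp cn (@sqrt_continuous R _).
(* sqrt |t| times the quotient tends to 0, yet is bounded below by 8/3 *)
have lim0 : Num.sqrt `|t| * second_quotient g t @[t --> (0 : R)^'] --> (0 : R).
  by rewrite -[X in _ --> X](mul0r l); exact: cvgM.
suff h : \forall t \near (0 : R)^', 8 / 3 <= Num.sqrt `|t| * second_quotient g t.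
  have : (8 / 3 : R) <= 0 by exact: cvgr_to_ge lim0 h.
  by rewrite leNgt divr_gt0.
rewrite near_withinE; exists d => //= t; rewrite /= add0r normrN => td t0.
have ft : profile A (4 / 3) K 0 e C t <= g t by apply: fg; rewrite /= add0r normrN.
have fNt : profile A (4 / 3) K 0 e C (- t) <= g (- t).
  by apply: fg; rewrite /= add0r opprK.
have t2 : 0 < t ^+ 2 by rewrite exprn_even_gt0.
rewrite /second_quotient mulrA ler_pdivlMr// -fg0.
set r := Num.sqrt `|t|.
have r0 : 0 <= r by exact: sqrtr_ge0.
have rr : r ^+ 4 = t ^+ 2.
  by rewrite (exprM r 2 2) sqr_sqrtr// real_normK// num_real.
have : 8 / 3 * r ^+ 3 <= g t + g (- t) - 2 * profile A (4 / 3) K 0 e C 0.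
  apply: le_trans (lerB (lerD ft fNt) (lexx _)).
  rewrite /profile !add0r pow32N normrN normr0 addr0.
  have -> : pow32 (0 : R) = 0 by rewrite /pow32 normr0 sqrtr0 expr0n.
  have : 0 <= A * `|t| by rewrite mulr_ge0.
  have : 0 <= K * t ^+ 2 by rewrite mulr_ge0// ltW.
  rewrite /pow32 -/r.
  nra.
move=> /(ler_wpM2l r0); rewrite -rr.
have -> : r * (8 / 3 * r ^+ 3) = 8 / 3 * r ^+ 4 by ring.
done.
Qed.

(** * The singular solution *)

(** The sum of the first two coordinates, which vanishes on the singular set. *)
Definition sing_coord {R : realType} {m : nat} (x : 'rV[R]_m.+3) : R :=
  x 0 (Ordinal (isT : (0 < m.+3)%N)) + x 0 (Ordinal (isT : (1 < m.+3)%N)).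

Definition third_coord {R : realType} {m : nat} (x : 'rV[R]_m.+3) : R :=
  x 0 (Ordinal (isT : (2 < m.+3)%N)).

(** The solution [|s| z^2 / 2 + (4/3) |s|^(3/2) + (x_4^2 + ... + x_n^2) / 2],
    where [s] is [sing_coord x] and [z] is [third_coord x]; coordinates are
    numbered from [0] in the sum. *)
Definition sing_sol {R : realType} {m : nat} (x : 'rV[R]_m.+3) : R :=
  2^-1 * `|sing_coord x| * third_coord x ^+ 2 + 4 / 3 * pow32 (sing_coord x) +
  2^-1 * \sum_(i < m.+3 | (2 < i)%N) x 0 i ^+ 2.

Section SingSol.
Context {R : realType} {m : nat}.
Implicit Types (x : 'rV[R]_m.+3) (i : 'I_m.+3) (t : R).

Let lineE x i t j : (x + t *: delta_mx 0 i) 0 j = x 0 j + t * (i == j)%:R.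
Proof. by rewrite !mxE eq_sym. Qed.

Lemma sing_coord_line x i t :
  sing_coord (x + t *: delta_mx 0 i) = sing_coord x + t * (i < 2)%N%:R.
Proof.
rewrite /sing_coord !lineE; case: i => -[|[|k]] ki; rewrite -!val_eqE /=; ring.
Qed.

Lemma third_coord_line x i t :
  third_coord (x + t *: delta_mx 0 i) = third_coord x + t * (i == 2 :> nat)%:R.
Proof. by rewrite /third_coord lineE. Qed.

Lemma sum_line x i t :
  \sum_(j < m.+3 | (2 < j)%N) (x + t *: delta_mx 0 i) 0 j ^+ 2 =
  \sum_(j < m.+3 | (2 < j)%N) x 0 j ^+ 2 +
  (2 < i)%N%:R * ((x 0 i + t) ^+ 2 - x 0 i ^+ 2).
Proof.
have [i2|i2] := boolP (2 < i)%N.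
  rewrite (bigD1 i)//= [in RHS](bigD1 i)//= lineE eqxx.
  under eq_bigr => j /andP[_ ji] do rewrite lineE eq_sym (negbTE ji) mulr0 addr0.
  by rewrite mul1r mulr1; ring.
rewrite mul0r addr0; apply: eq_bigr => j j2; rewrite lineE.
by have [ij|_] := eqVneq i j; [rewrite ij j2 in i2|rewrite mulr0 addr0].
Qed.

Lemma sing_sol_line_lt2 x i : (i < 2)%N ->
  (fun t => sing_sol (x + t *: delta_mx 0 i)) =
  profile (2^-1 * third_coord x ^+ 2) (4 / 3) 0 (sing_coord x) 0
    (2^-1 * \sum_(j < m.+3 | (2 < j)%N) x 0 j ^+ 2).
Proof.
move=> i2; apply/funext => t.
rewrite /sing_sol /profile sing_coord_line third_coord_line sum_line i2.
by rewrite ltn_eqF// ltnNge ltnW//= mulr1; ring.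
Qed.

(** The coefficients of the singular part vanish in the next two lemmas, so its
    base point is immaterial; the choice [1] keeps it away from [0]. *)
Lemma sing_sol_line_eq2 x i : i = 2 :> nat ->
  (fun t => sing_sol (x + t *: delta_mx 0 i)) =
  profile 0 0 (2^-1 * `|sing_coord x|) 1 (third_coord x)
    (sing_sol x - 2^-1 * `|sing_coord x| * third_coord x ^+ 2).
Proof.
move=> i2; apply/funext => t.
rewrite /sing_sol /profile sing_coord_line third_coord_line sum_line i2.
by rewrite /= mulr0 !addr0; ring.
Qed.

Lemma sing_sol_line_gt2 x i : (2 < i)%N ->
  (fun t => sing_sol (x + t *: delta_mx 0 i)) =
  profile 0 0 2^-1 1 (x 0 i) (sing_sol x - 2^-1 * x 0 i ^+ 2).
Proof.
move=> i2; apply/funext => t.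
rewrite /sing_sol /profile sing_coord_line third_coord_line sum_line i2.
by rewrite gtn_eqF// ltnNge ltnW//= mulr0 !addr0; ring.
Qed.

Lemma sing_sol_continuous : continuous (@sing_sol R m).
Proof.
have coord j (x : 'rV[R]_m.+3) : {for x, continuous (fun y : 'rV[R]_m.+3 => y 0 j)}.
  exact: coord_continuous.
have cs (x : 'rV[R]_m.+3) : {for x, continuous (@sing_coord R m)}.
  exact: (continuousD (coord _ x) (coord _ x)).
suff : forall x : 'rV[R]_m.+3, {for x, continuous (@sing_sol R m)} by [].
move=> x.
have abs : {for x, continuous (fun y : 'rV[R]_m.+3 => `|sing_coord y|)}.
  exact: (continuous_comp (cs x) (@norm_continuous R R _)).
have sqr j : {for x, continuous (fun y : 'rV[R]_m.+3 => y 0 j ^+ 2)}.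
  exact: (continuous_comp (coord j x) (@exprn_continuous R 2 _)).
have pow : {for x, continuous (fun y : 'rV[R]_m.+3 => pow32 (sing_coord y))}.
  exact: (continuous_comp (cs x) (@pow32_continuous R _)).
have sum : {for x, continuous (fun y : 'rV[R]_m.+3 =>
    \sum_(i < m.+3 | (2 < i)%N) y 0 i ^+ 2)}.
  exact: (cvg_big (@add_continuous R) _ (fun i _ => sqr i)).
have cst (c : R) : {for x, continuous (fun _ : 'rV[R]_m.+3 => c)}.
  exact: cst_continuous.
exact: (continuousD (continuousD
  (continuousM (continuousM (cst 2^-1) abs) (sqr _))
  (continuousM (cst (4 / 3)) pow)) (continuousM (cst 2^-1) sum)).
Qed.

Lemma sing_sol_coordinate_convex : coordinate_convex (@sing_sol R m).
Proof.
move=> x i w a b _ _; rewrite convRE.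
have -> : conv w a b = w%:num * (a : R) + (1 - w%:num) * (b : R) by exact: convRE.
have w01 : 0 <= w%:num <= 1 by apply/andP; split; [exact: ge0|exact: le1].
have [i2|i2|i2] := ltngtP (i : nat) 2.
- rewrite -/((fun t => sing_sol (x + t *: delta_mx 0 i)) _).
  have E t := congr1 (@^~ t) (sing_sol_line_lt2 x i i2); rewrite /= in E.
  rewrite !E; apply: profile_convex => //.
  by apply: mulr_ge0; [rewrite invr_ge0|exact: sqr_ge0].
- have E t := congr1 (@^~ t) (sing_sol_line_gt2 x i i2); rewrite /= in E.
  by rewrite !E; apply: profile_convex.
- have E t := congr1 (@^~ t) (sing_sol_line_eq2 x i i2); rewrite /= in E.
  by rewrite !E; apply: profile_convex; rewrite ?mulr_ge0.
Qed.

(** The pure second derivative of the solution in the direction of index [k],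
    off the singular set or for [k >= 2]. *)
Definition sing_sol_pure2 x (k : nat) : R :=
  if (k < 2)%N then (Num.sqrt `|sing_coord x|)^-1
  else if k == 2 then `|sing_coord x| else 1.

(** In the directions parallel to the singular set, the formula holds on that
    set as well. *)
Lemma second_quotient_sing_sol x i : sing_coord x != 0 \/ (1 < i)%N ->
  second_quotient (fun t => sing_sol (x + t *: delta_mx 0 i)) t @[t --> 0^']
    --> sing_sol_pure2 x i.
Proof.
rewrite /sing_sol_pure2; have [i2|i2|i2] := ltngtP (i : nat) 2.
- case=> [s0|//].
  rewrite sing_sol_line_lt2//.
  have := @second_quotient_profile R (2^-1 * third_coord x ^+ 2) (4 / 3) 0
    (sing_coord x) 0 (2^-1 * \sum_(j < m.+3 | (2 < j)%N) x 0 j ^+ 2) s0.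
  by congr (_ --> _); field; rewrite sqrtr_eq0 -ltNge normr_gt0.
- move=> _; rewrite sing_sol_line_gt2//.
  have := @second_quotient_profile R 0 0 2^-1 1 (x 0 i)
    (sing_sol x - 2^-1 * x 0 i ^+ 2) (oner_neq0 _).
  by rewrite mul0r add0r mulfV.
- move=> _; rewrite sing_sol_line_eq2//.
  have := @second_quotient_profile R 0 0 (2^-1 * `|sing_coord x|) 1 (third_coord x)
    (sing_sol x - 2^-1 * `|sing_coord x| * third_coord x ^+ 2) (oner_neq0 _).
  by rewrite mul0r add0r [2 * _]mulrA mulfV// mul1r.
Qed.

Lemma prod_sing_sol_pure2 x : sing_coord x != 0 ->
  \prod_(i < m.+3) sing_sol_pure2 x i = 1.
Proof.
move=> s0; rewrite 3!big_ord_recl big1 => [|i _].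
  rewrite /sing_sol_pure2 /= mulr1 mulrA -invfM -expr2 sqr_sqrtr//.
  by rewrite mulVf// normr_eq0.
by rewrite /sing_sol_pure2.
Qed.

Lemma sing_sol_no_C2_above (psi : 'rV[R]_m.+3 -> R) x :
  sing_coord x = 0 -> Ck_near 2 x psi -> psi x = sing_sol x ->
  ~ (\forall y \near x, sing_sol y <= psi y).
Proof.
move=> s0 Cpsi psix above.
have := second_quotient_line psi x ord0 Cpsi.
have E := sing_sol_line_lt2 x ord0 isT; rewrite s0 in E.
apply: (@profile_kink_not_below R (2^-1 * third_coord x ^+ 2) 0 0
  (2^-1 * \sum_(j < m.+3 | (2 < j)%N) x 0 j ^+ 2)) => //.
- by apply: mulr_ge0; [rewrite invr_ge0|exact: sqr_ge0].
- by rewrite -E scale0r addr0.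
- by rewrite -E; exact: (line_cvg x (delta_mx 0 ord0) _ above).
Qed.

Lemma sing_sol_subsolution : viscosity_subsolution [set: 'rV[R]_m.+3] sing_sol.
Proof.
move=> x psi _ Cpsi psix above.
have [s0|s0] := eqVneq (sing_coord x) 0.
  by case: (sing_sol_no_C2_above psi x s0 Cpsi psix above).
have le i : sing_sol_pure2 x i <= partial i (partial i psi) x.
  apply: (second_quotient_le _ _ _ _ _ _
    (second_quotient_sing_sol x i (or_introl s0))
    (second_quotient_line psi x i Cpsi)).
  - by rewrite scale0r addr0 psix.
  - exact: (line_cvg x (delta_mx 0 i) _ above).
have ge0 i : 0 <= sing_sol_pure2 x i.
  rewrite /sing_sol_pure2; case: ifP => _; first by rewrite invr_ge0 sqrtr_ge0.
  by case: ifP.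
split=> [i|]; first exact: le_trans (ge0 i) (le i).
rewrite -[leLHS](prod_sing_sol_pure2 x s0).
by apply: ler_prod => i _; rewrite ge0 le.
Qed.

Lemma sing_sol_supersolution :
  viscosity_supersolution [set: 'rV[R]_m.+3] sing_sol.
Proof.
move=> x psi _ Cpsi psix below psi_ge0.
have le i : sing_coord x != 0 \/ (1 < i)%N ->
    partial i (partial i psi) x <= sing_sol_pure2 x i.
  move=> si; apply: (second_quotient_le _ _ _ _ _ _
    (second_quotient_line psi x i Cpsi) (second_quotient_sing_sol x i si)).
  - by rewrite scale0r addr0 psix.
  - exact: (line_cvg x (delta_mx 0 i) _ below).
have [s0|s0] := eqVneq (sing_coord x) 0; last first.
  rewrite -[leRHS](prod_sing_sol_pure2 x s0); apply: ler_prod => i _.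
  by rewrite psi_ge0 le//; left.
(* on the singular set the factor of index 2 vanishes *)
pose i2 := Ordinal (isT : (2 < m.+3)%N).
rewrite (bigD1 i2)//=.
have -> : partial i2 (partial i2 psi) x = 0.
  apply/eqP; rewrite eq_le psi_ge0 andbT.
  by have := le i2 (or_intror isT); rewrite /sing_sol_pure2 /= s0 normr0.
by rewrite mul0r.
Qed.

Lemma sing_sol_not_C2 : ~ Ck_on 2 [set: 'rV[R]_m.+3] sing_sol.
Proof.
move=> C2; apply: (sing_sol_no_C2_above sing_sol 0) => //.
- by rewrite /sing_coord !mxE addr0.
- by exists setT; split=> //; split; [exact: openT|].
- by apply: (@filterE _ (nbhs (0 : 'rV[R]_m.+3))) => y.
Qed.

End SingSol.

Theorem theorem1p8 (R : realType) (n : nat) (hn : (3 <= n)%N) :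
  exists u : 'rV[R]_n -> R,
    continuous u /\ coordinate_convex u /\
    viscosity_solution [set: 'rV[R]_n] u /\
    ~ Ck_on 2 [set: 'rV[R]_n] u.
Proof.
case: n hn => [|[|[|m]]] // _; exists sing_sol.
split; first exact: sing_sol_continuous.
split; first exact: sing_sol_coordinate_convex.
split; last exact: sing_sol_not_C2.
by split; [exact: sing_sol_subsolution|exact: sing_sol_supersolution].
Qed.
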